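(* Let $r\ge2$ and let $\mathcal A_q$, $\mathcal I$, $\mathcal I_q$, $\mathcal B_{\rm irr}$ and $\phi$ be as defined in the context. The $\mathbb Z[q,q^{-1}]$-module isomorphism $\phi:\mathcal A_q\to\mathcal A_q$ induces a $\mathbb Z[q,q^{-1}]$-module isomorphism $\overline\phi:\mathcal A_q/\mathcal I\to\mathcal A_q/\mathcal I_q$, $E+\mathcal I\mapsto\phi(E)+\mathcal I_q$. In particular, the $q$-right quantum algebra $\mathcal R_q=\mathcal A_q/\mathcal I_q$ has the same basis as the $1$-right quantum algebra $\mathcal R$, namely (the classes of) the set $\mathcal B_{\rm irr}$ of irreducible biwords.
   Context: Fix an integer $r\ge 2$ and the alphabet $\mathbb A=\{1,2,\dots,r\}$. A biword is a $2\times n$ matrix $\alpha=\binom{x_1\cdots x_n}{a_1\cdots a_n}$ ($n\ge 0$) with entries in $\mathbb A$, of length $\ell(\alpha)=n$, viewed as the word $\binom{x_1}{a_1}\cdots\binom{x_n}{a_n}$ in biletters; the product of biwords is concatenation, the empty biword is the unit $1$, and $\mathcal B$ is the set of all biwords. A biword is irreducible if there is no $i$ with $x_i>x_{i+1}$ and $a_i\ge a_{i+1}$; $\mathcal B_{\rm irr}$ is the set of irreducible biwords. $\mathcal A_q=\mathbb Z[q,q^{-1}]\langle\langle\mathcal B\rangle\rangle$ is the algebra of all (possibly infinite) formal sums $E=\sum_{\alpha\in\mathcal B}c(\alpha)\alpha$, $c(\alpha)\in\mathbb Z[q,q^{-1}]$, with product induced by concatenation; $\mathcal A=\mathbb Z\langle\langle\mathcal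 B\rangle\rangle$ is the analogous algebra with integer coefficients. $E^{(n)}=\sum_{\ell(\alpha)=n}c(\alpha)\alpha$ (a finite sum) is the degree-$n$ homogeneous component. Relations. For $x>y$ in $\mathbb A$ put $$\left[{xy\atop ab}\right]=\binom{yx}{ba}+\binom{yx}{ab}-\binom{xy}{ba}\ (a>b),\quad \left[{xy\atop aa}\right]=\binom{yx}{aa}\ (\text{all } a),$$ $$\left[{xy\atop ab}\right]_q=\binom{yx}{ba}+q\binom{yx}{ab}-q^{-1}\binom{xy}{ba}\ (a>b),\quad \left[{xy\atop aa}\right]_q=q\binom{yx}{aa}\ (\text{all } a).$$ Ideals. $\mathcal I$ (resp. $\mathcal I_q$) denotes the two-sided ideal of $\mathcal A_q$ generated by the elements $\binom{xy}{ab}-\left[{xy\atop ab}\right]$ (resp. $\binom{xy}{ab}-\left[{xy\atop ab}\right]_q$), $x>y$, $a\ge b$. This is understood degreewise: $E$ belongs to the ideal if and only if, for every $n\ge0$, $E^{(n)}$ belongs to the two-sided ideal generated by the same elements in the algebra $\mathbb Z[q,q^{-1}]\langle\mathcal B\rangle$ of finite sums. $\mathcal R=\mathcal A/\mathcal I$, where here $\mathcal I$ is the ideal of $\mathcal A$ defined in the same way over $\mathbb Z$ by the relations without $q$; $\mathcal R$ has basis $\mathcal B_{\rm irr}$ over $\mathbb Z$. ''Basis'' is in the sense of formal sums: each element is uniquely the class of a (possibly infinite) formal linear combination of elements of $\mathcal B_{\rm irr}$ (coefficients in $\mathbb Z[q,q^{-1}]$ for $\mathcal R_q$). Weight. For a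 word $w=w_1\cdots w_n$, $\operatorname{inv}w=\#\{(i,j):1\le i<j\le n,\ w_i>w_j\}$. For a biword $\alpha=\binom uv$, $\operatorname{inv}^-(\alpha)=\operatorname{inv}v-\operatorname{inv}u$. The map $\phi:\mathcal A_q\to\mathcal A_q$ is given by $\phi\bigl(\sum_\alpha c(\alpha)\alpha\bigr)=\sum_\alpha c(\alpha)q^{\operatorname{inv}^-(\alpha)}\alpha$; it is a $\mathbb Z[q,q^{-1}]$-module isomorphism. *)

(* Defs.v *)
From HB Require Import structures.
From mathcomp Require Import all_boot all_order all_algebra.
From mathcomp Require Import generic_quotient ring_quotient fraction.
From mathcomp Require Import boolp functions.
From mathcomp Require Import monalg.

Set Implicit Arguments.
Unset Strict Implicit.
Unset Printing Implicit Defensive.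

Import GRing.Theory.

Local Open Scope ring_scope.
Local Open Scope quotient_scope.

(* The ring Z[q, q^-1], as the subring of the fraction field of Z[X] of the
   elements of the form p / X^n. *)

Section Laurent.

Local Notation F := {fraction {poly int}}.

Definition fracX : F := FracField.tofrac 'X.

Definition is_laurent : {pred F} :=
  fun x => `[< exists (p : {poly int}) (n : nat),
                 x = FracField.tofrac p / fracX ^+ n >].

Lemma fracX_neq0 : fracX != 0.
Proof. by rewrite tofrac_eq0 polyX_eq0. Qed.

Lemma is_laurent_subring : subring_closed is_laurent.
Proof.
have fX0 n : fracX ^+ n != 0 by rewrite expf_neq0 // fracX_neq0.
split=> [|x y|x y].
- by apply/asboolP; exists 1, 0; rewrite tofrac1 expr0 divr1.
- move=> /asboolP[p [n ->]] /asboolP[s [m ->]]; apply/asboolP.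
  exists (p * 'X^m - s * 'X^n), (n + m)%N.
  rewrite tofracB !tofracM !tofracXn -/fracX exprD mulrBl.
  congr (_ - _); first by rewrite -mulf_div divff // mulr1.
  by rewrite [fracX ^+ n * _]mulrC -mulf_div divff // mulr1.
- move=> /asboolP[p [n ->]] /asboolP[s [m ->]]; apply/asboolP.
  by exists (p * s), (n + m)%N; rewrite tofracM exprD mulf_div.
Qed.

HB.instance Definition _ :=
  GRing.isSubringClosed.Build F is_laurent is_laurent_subring.

Record laurent := Laurent { laurent_val : F; _ : laurent_val \in is_laurent }.

HB.instance Definition _ := [isSub for laurent_val].
HB.instance Definition _ := [Choice of laurent by <:].
HB.instance Definition _ := [SubChoice_isSubComNzRing of laurent by <:].

Definition laurent_unit : pred laurent :=
  fun x => (val x != 0) && ((val x)^-1 \in is_laurent).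

Definition laurent_inv (x : laurent) : laurent := insubd x (val x)^-1.

Lemma laurent_mulVr : {in laurent_unit, left_inverse 1 laurent_inv *%R}.
Proof.
move=> x /andP[x0 xV]; apply: val_inj.
by rewrite rmorphM /= val_insubd xV mulVf ?rmorph1.
Qed.

Lemma laurent_unitP (x y : laurent) : y * x = 1 -> laurent_unit x.
Proof.
move=> /(congr1 val); rewrite rmorphM rmorph1 /= => yx.
have x0 : val x != 0.
  by apply/eqP => x0; move/eqP: yx; rewrite x0 mulr0 eq_sym oner_eq0.
rewrite /laurent_unit x0 /=.
suff -> : (val x)^-1 = val y by exact: valP.
by rewrite -[LHS]mul1r -yx mulfK.
Qed.

Lemma laurent_inv_out : {in [predC laurent_unit], laurent_inv =1 id}.
Proof.
move=> x /nandP[/negPn/eqP x0|xV]; apply: val_inj; rewrite val_insubd.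
  by rewrite x0 invr0; case: ifP.
by rewrite (negbTE xV).
Qed.

HB.instance Definition _ := GRing.ComNzRing_hasMulInverse.Build laurent
  laurent_mulVr laurent_unitP laurent_inv_out.

Lemma laurent_q_subproof : fracX \in is_laurent.
Proof. by apply/asboolP; exists 'X, 0; rewrite expr0 divr1. Qed.

Definition lq : laurent := Laurent laurent_q_subproof.

Lemma lq_unit : lq \is a GRing.unit.
Proof.
apply/andP; split; first exact: fracX_neq0.
by apply/asboolP; exists 1, 1; rewrite tofrac1 expr1 mul1r.
Qed.

End Laurent.

(* The library provides the quotient of an additive group by a subgroup; here it
   is equipped with the scalar multiplication in the case of a submodule. *)

Section LmodQuotient.

Variables (R : pzRingType) (V : lmodType R) (I : submodClosed V).

Definition submod_pred : {pred V} := I.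

Lemma submod_pred_zmod : zmod_closed submod_pred.
Proof. exact: GRing.submod_closedB (GRing.submodClosedP I). Qed.

HB.instance Definition _ :=
  GRing.isZmodClosed.Build V submod_pred submod_pred_zmod.

Definition lmod_quot : Type := Quotient.quot submod_pred.

HB.instance Definition _ := GRing.Zmodule.on lmod_quot.

Definition cls (v : V) : lmod_quot := \pi_(Quotient.quot submod_pred) v.

Definition cls_repr (x : lmod_quot) : V :=
  repr (x : Quotient.quot submod_pred).

Lemma cls_reprK : cancel cls_repr cls.
Proof. by move=> x; exact: reprK. Qed.

Lemma cls_eq (u v : V) : (cls u = cls v) <-> (u - v \in I).
Proof.
have E : (u - v \in I) = (cls u == cls v).
  exact: (Quotient.idealrBE submod_pred u v).
by rewrite E; split=> /eqP.
Qed.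

Lemma clsD : {morph cls : u v / u + v}.
Proof. by move=> u v; rewrite /cls !piE. Qed.

Definition quot_scale (a : R) (x : lmod_quot) : lmod_quot :=
  cls (a *: cls_repr x).

Lemma quot_scale_cls a v : quot_scale a (cls v) = cls (a *: v).
Proof.
apply/cls_eq; rewrite -scalerBr; apply: rpredZ; apply/cls_eq.
exact: cls_reprK.
Qed.

Lemma quot_scaleA a b x : quot_scale a (quot_scale b x) = quot_scale (a * b) x.
Proof. by rewrite -(cls_reprK x) !quot_scale_cls scalerA. Qed.

Lemma quot_scale1 : left_id 1 quot_scale.
Proof. by move=> x; rewrite -(cls_reprK x) quot_scale_cls scale1r. Qed.

Lemma quot_scaleDr : right_distributive quot_scale +%R.
Proof.
move=> a x y; rewrite -(cls_reprK x) -(cls_reprK y) -clsD !quot_scale_cls.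
by rewrite scalerDr clsD.
Qed.

Lemma quot_scaleDl x : {morph quot_scale^~ x : a b / a + b}.
Proof. by move=> a b; rewrite -(cls_reprK x) !quot_scale_cls scalerDl clsD. Qed.

HB.instance Definition _ := GRing.Zmodule_isLmodule.Build R lmod_quot
  quot_scaleA quot_scale1 quot_scaleDr quot_scaleDl.

Lemma cls_is_linear : linear cls.
Proof. by move=> a u v; rewrite clsD -quot_scale_cls. Qed.

HB.instance Definition _ :=
  GRing.isLinear.Build R V lmod_quot _ cls cls_is_linear.

End LmodQuotient.

Section TwoSidedIdeal.

Variable A : pzRingType.

Inductive two_sided_ideal (G : A -> Prop) : A -> Prop :=
| two_sided_ideal_gen g : G g -> two_sided_ideal G g
| two_sided_ideal0 : two_sided_ideal G 0
| two_sided_idealD f g :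
    two_sided_ideal G f -> two_sided_ideal G g -> two_sided_ideal G (f + g)
| two_sided_idealMl f g : two_sided_ideal G g -> two_sided_ideal G (f * g)
| two_sided_idealMr f g : two_sided_ideal G f -> two_sided_ideal G (f * g).

End TwoSidedIdeal.

(* The alphabet {1 < ... < r} is represented by 'I_r = {0 < ... < r - 1}, and the
   biword (x_1 ... x_n / a_1 ... a_n) by the word of its columns (x_i, a_i) in
   the free monoid. *)

Section Biwords.

Variable r : nat.

Definition biword := {fmonom ('I_r * 'I_r)%type}.

Definition top_row (w : biword) : seq 'I_r := [seq c.1 | c <- (w : seq _)].
Definition bottom_row (w : biword) : seq 'I_r := [seq c.2 | c <- (w : seq _)].

Definition bi2 (x y a b : 'I_r) : biword := FMonom [:: (x, a); (y, b)].

Definition no_descent (c d : 'I_r * 'I_r) : bool :=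
  ~~ ((d.1 < c.1)%N && (d.2 <= c.2)%N).

Definition irreducible (w : biword) : bool := sorted no_descent w.

Definition inversions (w : seq 'I_r) : nat :=
  #|[set p : 'I_(size w) * 'I_(size w) |
      (p.1 < p.2)%N && (tnth (in_tuple w) p.2 < tnth (in_tuple w) p.1)%N]|.

Definition inv_minus (w : biword) : int :=
  (inversions (bottom_row w))%:Z - (inversions (top_row w))%:Z.

End Biwords.

(* A possibly infinite formal sum is the family of its coefficients, with the
   pointwise module structure. Finite sums are elements of the monoid algebra
   {malg K[biword r]} of the free monoid, whose product is concatenation. *)

Definition series (r : nat) (K : comNzRingType) : Type := biword r -> K^o.

HB.instance Definition _ (r : nat) (K : comNzRingType) :=
  GRing.Lmodule.copy (series r K) (biword r -> K^o).

Section FormalIdeals.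

Variables (r : nat) (K : comNzRingType).

Local Notation series := (series r K).
Local Notation finsum := {malg K[biword r]}.

Definition homog (n : nat) (E : series) : finsum :=
  \sum_(t : n.-tuple ('I_r * 'I_r)%type) << E (FMonom t) *g FMonom t >>.

Lemma homog_is_linear n : linear (homog n).
Proof.
move=> a E F; rewrite /homog scaler_sumr -big_split /=.
apply: eq_bigr => t _; apply/malgP => w.
by rewrite mcoeffD mcoeffZ !mcoeffU /= mulrnDl mulrnAr.
Qed.

HB.instance Definition _ n :=
  GRing.isLinear.Build K series finsum _ (homog n) (homog_is_linear n).

(* Membership is tested degree by degree, in the algebra of finite sums. *)
Definition in_ideal (G : finsum -> Prop) : {pred series} :=
  fun E => `[< forall n, two_sided_ideal G (homog n E) >].

Variable G : finsum -> Prop.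

Lemma in_ideal_submod : submod_closed (in_ideal G).
Proof.
split.
  apply/asboolP => n; rewrite raddf0.
  exact: two_sided_ideal0.
move=> a E F /asboolP IE /asboolP IF; apply/asboolP => n.
rewrite linearP; apply: two_sided_idealD (IF n) => /=.
have -> : a *: homog n E = (a *: 1) * homog n E by rewrite -scalerAl mul1r.
exact: two_sided_idealMl.
Qed.

HB.instance Definition _ :=
  GRing.isSubmodClosed.Build K series (in_ideal G) in_ideal_submod.

End FormalIdeals.

Section Relations.

Variable r : nat.

Section One.

Variable K : comNzRingType.

Local Notation finsum := {malg K[biword r]}.

(* The brackets are only used for b <= a. *)
Definition bracket (x y a b : 'I_r) : finsum :=
  if a == b then << bi2 y x a a >>
  else << bi2 y x b a >> + << bi2 y x a b >> - << bi2 x y b a >>.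

Definition rel1 (g : finsum) : Prop :=
  exists x y a b : 'I_r,
    [/\ (y < x)%N, (b <= a)%N & g = << bi2 x y a b >> - bracket x y a b].

End One.

Local Notation finsum := {malg laurent[biword r]}.

Definition bracketq (x y a b : 'I_r) : finsum :=
  if a == b then lq *: << bi2 y x a a >>
  else << bi2 y x b a >> + lq *: << bi2 y x a b >> - lq^-1 *: << bi2 x y b a >>.

Definition relq (g : finsum) : Prop :=
  exists x y a b : 'I_r,
    [/\ (y < x)%N, (b <= a)%N & g = << bi2 x y a b >> - bracketq x y a b].

End Relations.

Section Algebras.

Variables (r : nat).

Definition ideal1 (K : comNzRingType) : submodClosed (series r K) :=
  in_ideal (@rel1 r K).

Definition idealq : submodClosed (series r laurent) := in_ideal (@relq r).

Definition phi (E : series r laurent) : series r laurent :=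
  fun w => E w * lq ^ inv_minus w.

Lemma phi_is_linear : linear phi.
Proof.
by move=> a E F; apply/funext => w; rewrite /phi /= mulrDl -mulrA.
Qed.

HB.instance Definition _ := GRing.isLinear.Build laurent
  (series r laurent) (series r laurent) _ phi phi_is_linear.

Lemma phi_bij : bijective phi.
Proof.
have u w : lq ^ inv_minus (w : biword r) \is a GRing.unit.
  exact/unitrXz/lq_unit.
exists (fun E w => E w / lq ^ inv_minus w) => E; apply/funext => w.
  exact: mulrK.
exact: mulrVK.
Qed.

End Algebras.

(* Basis in the sense of formal, possibly infinite, linear combinations. *)
Definition formal_basis (r : nat) (K : comNzRingType)
    (I : submodClosed (series r K)) (B : pred (biword r)) : Prop :=
  forall x : lmod_quot I,
    exists! E : series r K, (forall w, ~~ B w -> E w = 0) /\ cls I E = x.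

(* Main.v *)
(* The relations are oriented as rewriting rules that replace an adjacent
   pair of columns (x, a), (y, b) with x > y and a >= b. Each rule decreases
   the total number of inversions of the two rows, so every biword reduces to
   a combination of irreducible ones. The only critical pairs come from three
   columns with x > y > z and a >= b >= c, and they are confluent (four cases
   according to the equalities among a, b, c); hence the coefficient of an
   irreducible biword in the normal form is a linear functional that kills
   the ideal, and irreducible biwords are independent modulo the ideal.

   For the q-deformation, permuting adjacent columns inside a biword changes
   inv^- by an amount that depends only on these columns, and the powers of q
   in the q-relations are exactly these amounts. So phi maps u * g * v, for g
   a relation, to a power of q times u * g_q * v, and phi exchanges the two
   ideals and preserves the support. *)

Require Import Defs.
From HB Require Import structures.
From mathcomp Require Import all_boot all_order all_algebra.
From mathcomp Require Import finmap boolp functions monalg zify ring.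

Set Implicit Arguments.
Unset Strict Implicit.
Unset Printing Implicit Defensive.

Import GRing.Theory.

Local Open Scope ring_scope.

(** * Inversion numbers of concatenated words *)

Section Inversions.

Variable r : nat.
Implicit Types s t u v : seq 'I_r.

Fixpoint inv_count s : nat :=
  if s is x :: s'
  then (count (fun y : 'I_r => y < x) s' + inv_count s')%N else 0.

Lemma inversionsE s : inversions s = inv_count s.
Proof.
have E s' : inversions s' = (\sum_(i < size s') \sum_(j < size s')
    ((i < j) && (tnth (in_tuple s') j < tnth (in_tuple s') i)))%N.
  rewrite /inversions cardsE -sum1_card big_mkcond /= pair_bigA /=.
  by apply: eq_bigr => -[i j] _; rewrite unfold_in /=; case: (_ && _).
elim: s => [|x s IH]; first by rewrite E big_ord0.
rewrite E big_ord_recl /= big_ord_recl /= add0n; congr addn.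
  rewrite -sum1_count [RHS]big_mkcond /= -[in RHS](in_tupleE s) big_tuple.
  apply: eq_bigr => j _.
  by rewrite !(tnth_nth x) /=; case: ifP.
rewrite -IH E; apply: eq_bigr => i _; rewrite big_ord_recl /= add0n.
by apply: eq_bigr => j _; rewrite !(tnth_nth x).
Qed.

Definition cross s t : nat := \sum_(x <- s) count (fun y : 'I_r => y < x)%N t.

Lemma inv_cat s t : inv_count (s ++ t) = (inv_count s + inv_count t + cross s t)%N.
Proof.
rewrite /cross; elim: s => [|x s IH] /=; first by rewrite big_nil addn0.
by rewrite IH big_cons count_cat; lia.
Qed.

Lemma perm_cross s s' t t' :
  perm_eq s s' -> perm_eq t t' -> cross s t = cross s' t'.
Proof.
move=> ss tt; rewrite /cross (perm_big _ ss) /=.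
by apply: eq_bigr => x _; exact: (permP tt).
Qed.

(** Inversions between a factor and its context depend only on the letters of the factor, not on
    their order. The additive form avoids truncated subtraction. *)
Lemma inv_factor u v s t : perm_eq s t ->
  (inv_count (u ++ s ++ v) + inv_count t = inv_count (u ++ t ++ v) + inv_count s)%N.
Proof.
move=> st; rewrite !inv_cat.
rewrite (perm_cross st (perm_refl v)).
have -> : cross u (s ++ v) = cross u (t ++ v).
  by apply: perm_cross => //; rewrite perm_cat2r.
lia.
Qed.

End Inversions.

(** * The rewriting system: termination and the critical pairs *)

Section Rewriting.

Variable r : nat.
Local Notation C := ('I_r * 'I_r)%type.
Implicit Types (c d e f : C) (s t u v w : seq C).

Lemma ltn_asymF m n : (m < n)%N -> (n < m)%N = false.
Proof. by move=> mn; rewrite ltnNge ltnW. Qed.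

Definition descent c d : bool := (d.1 < c.1)%N && (d.2 <= c.2)%N.

Definition weight w : nat := (inv_count (map fst w) + inv_count (map snd w))%N.

Lemma ltn_weight u v s t :
    perm_eq (map fst s) (map fst t) -> perm_eq (map snd s) (map snd t) ->
  (weight s < weight t)%N -> (weight (u ++ s ++ v) < weight (u ++ t ++ v))%N.
Proof.
move=> p1 p2; rewrite /weight !map_cat.
have := inv_factor (map fst u) (map fst v) p1.
have := inv_factor (map snd u) (map snd v) p2.
lia.
Qed.

(* The right-hand side of the relation with left-hand side [c d], each biword of
   length 2 being replaced by its value under [F]. *)
Definition expand (V : zmodType) (F : C -> C -> V) c d : V :=
  if c.2 == d.2 then F d c
  else F d c + F (d.1, c.2) (c.1, d.2) - F (c.1, d.2) (d.1, c.2).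

(** A congruence rule for inductions on [weight]: each pair on the right of a rule rearranges both
    rows of [c d] and has strictly fewer inversions, so only such pairs have to be compared. *)
Lemma eq_expand_perm (V : zmodType) (F G : C -> C -> V) c d : descent c d ->
    (forall e f, perm_eq (map fst [:: e; f]) (map fst [:: c; d]) ->
       perm_eq (map snd [:: e; f]) (map snd [:: c; d]) ->
       (weight [:: e; f] < weight [:: c; d])%N -> F e f = G e f) ->
  expand F c d = expand G c d.
Proof.
case: c d => [x a] [y b] /andP[/= yx ba] FG; rewrite /expand /=.
have [ab|ab] := eqVneq a b.
  by subst b; apply: FG; try (by apply/permP => p /=; lia);
    rewrite /weight /= ltnn yx (ltn_asymF yx).
have {}ba : (b < a)%N.
  by rewrite ltn_neqAle ba andbT; apply: contra ab => /eqP/val_inj ->.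
by rewrite !FG //; (try by apply/permP => p /=; lia);
  rewrite /weight /= ?yx ?(ltn_asymF yx) ?ba ?(ltn_asymF ba).
Qed.

Lemma eq_expand (V : zmodType) (F G : C -> C -> V) c d : descent c d ->
    (forall e f, (forall u v,
       weight (u ++ [:: e, f & v]) < weight (u ++ [:: c, d & v]))%N ->
     F e f = G e f) ->
  expand F c d = expand G c d.
Proof.
move=> cd FG; apply: eq_expand_perm => // e f p1 p2 ef.
by apply: FG => u v; exact: (ltn_weight u v p1 p2 ef).
Qed.

Fixpoint descent_split w : option (seq C * C * C * seq C) :=
  if w is c :: w' then
    if w' is d :: v then
      if descent c d then Some ([::], c, d, v)
      else omap (fun '(u, c', d', v') => (c :: u, c', d', v')) (descent_split w')
    else None
  else None.

Lemma descent_splitP w :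
  if descent_split w is Some (u, c, d, v)
  then w = u ++ [:: c, d & v] /\ descent c d
  else sorted (@no_descent r) w.
Proof.
elim: w => [|c [|d v] IH] //.
have -> : descent_split [:: c, d & v] =
    if descent c d then Some ([::], c, d, v)
    else omap (fun '(u, c', d', v') => (c :: u, c', d', v'))
              (descent_split (d :: v)) by [].
case: ifP => // cd.
case: (descent_split (d :: v)) IH => [[[[u c'] d'] v']|]; first by case=> ->.
by rewrite /= {2}/no_descent -/(descent c d) cd.
Qed.

Lemma sorted_descent u c d v :
  descent c d -> sorted (@no_descent r) (u ++ [:: c, d & v]) = false.
Proof.
move=> cd; elim: u => [|e [|f u] IH] /=.
- by rewrite /no_descent -/(descent c d) cd.
- by rewrite {2}/no_descent -/(descent c d) cd andbF.
- by move: IH => /= ->; rewrite andbF.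
Qed.

Ltac small_word :=
  apply/and3P; split;
    [by apply/permP => p /=; lia | by apply/permP => p /=; lia |];
  rewrite /=;
  repeat match goal with
  | H : is_true (?i < ?j)%N |- _ => rewrite ?H ?(ltn_asymF H); clear H
  end;
  rewrite ?ltnn; done.

Ltac reduce_with E := rewrite E; [ | solve [assumption | small_word] ..].

(** Normalises triples by the four rules below. The side condition [small] blocks the original
    overlap, and each rewriting lowers the weight, so the loop stops. *)
Ltac nf F HL HLe HR HRe :=
  repeat match goal with
  | |- context [F (?x1, ?a1) (?x2, ?a2) (?x3, ?a3)] =>
    first [ reduce_with (HLe x1 x2 x3 a1 a3)
          | reduce_with (HL x1 x2 x3 a1 a2 a3)
          | reduce_with (HRe x1 x2 x3 a1 a3)
          | reduce_with (HR x1 x2 x3 a1 a2 a3) ]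
  end.

(** Confluence of a critical pair. As [F] respects the rules on all triples of smaller weight, both
    sides can be reduced until they are the same combination of values of [F]. An abstract [F]
    allows any surrounding context. *)
Lemma expand_overlap (K : comNzRingType) (F : C -> C -> C -> K) c d e :
    descent c d -> descent d e ->
    (forall c' d' e', (forall u v,
        weight (u ++ [:: c', d', e' & v]) < weight (u ++ [:: c, d, e & v]))%N ->
      (descent c' d' ->
       F c' d' e' = expand (fun f g => F f g e') c' d') /\
      (descent d' e' -> F c' d' e' = expand (F c') d' e')) ->
  expand (fun f g => F f g e) c d = expand (F c) d e.
Proof.
case: c d e => [x a] [y b] [z c] /andP[/= yx ba] /andP[/= zy cb] HF.
(* This condition on letters alone implies the weight bound in every context and can be checked
   automatically. *)
pose small (x1 x2 x3 a1 a2 a3 : 'I_r) :=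
  [&& perm_eq [:: x1; x2; x3] [:: x; y; z],
      perm_eq [:: a1; a2; a3] [:: a; b; c] &
      (inv_count [:: x1; x2; x3] + inv_count [:: a1; a2; a3] <
       inv_count [:: x; y; z] + inv_count [:: a; b; c])%N].
have {}HF x1 x2 x3 a1 a2 a3 : small x1 x2 x3 a1 a2 a3 ->
    (descent (x1, a1) (x2, a2) -> F (x1, a1) (x2, a2) (x3, a3) =
       expand (fun f g => F f g (x3, a3)) (x1, a1) (x2, a2)) /\
    (descent (x2, a2) (x3, a3) -> F (x1, a1) (x2, a2) (x3, a3) =
       expand (F (x1, a1)) (x2, a2) (x3, a3)).
  move=> /and3P[p1 p2 lt]; apply: HF => u v.
  exact: (@ltn_weight u v [:: (x1, a1); (x2, a2); (x3, a3)]
                          [:: (x, a); (y, b); (z, c)]).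
(* The rules at the left and at the right pair of a triple, each for distinct and for equal bottom
   letters. *)
have HL (x1 x2 x3 a1 a2 a3 : 'I_r) : (x2 < x1)%N -> (a2 < a1)%N ->
    small x1 x2 x3 a1 a2 a3 -> F (x1, a1) (x2, a2) (x3, a3) =
      F (x2, a2) (x1, a1) (x3, a3) + F (x2, a1) (x1, a2) (x3, a3)
      - F (x1, a2) (x2, a1) (x3, a3).
  move=> x21 a21 /HF[E _]; rewrite E; last by rewrite /descent /= x21 ltnW.
  by rewrite /expand /= -val_eqE gtn_eqF.
have HLe (x1 x2 x3 a1 a3 : 'I_r) : (x2 < x1)%N ->
    small x1 x2 x3 a1 a1 a3 -> F (x1, a1) (x2, a1) (x3, a3) =
      F (x2, a1) (x1, a1) (x3, a3).
  move=> x21 /HF[E _]; rewrite E; last by rewrite /descent /= x21 leqnn.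
  by rewrite /expand /= eqxx.
have HR (x1 x2 x3 a1 a2 a3 : 'I_r) : (x3 < x2)%N -> (a3 < a2)%N ->
    small x1 x2 x3 a1 a2 a3 -> F (x1, a1) (x2, a2) (x3, a3) =
      F (x1, a1) (x3, a3) (x2, a2) + F (x1, a1) (x3, a2) (x2, a3)
      - F (x1, a1) (x2, a3) (x3, a2).
  move=> x32 a32 /HF[_ E]; rewrite E; last by rewrite /descent /= x32 ltnW.
  by rewrite /expand /= -val_eqE gtn_eqF.
have HRe (x1 x2 x3 a1 a3 : 'I_r) : (x3 < x2)%N ->
    small x1 x2 x3 a1 a3 a3 -> F (x1, a1) (x2, a3) (x3, a3) =
      F (x1, a1) (x3, a3) (x2, a3).
  move=> x32 /HF[_ E]; rewrite E; last by rewrite /descent /= x32 leqnn.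
  by rewrite /expand /= eqxx.
rewrite /expand /=.
have zx := ltn_trans zy yx.
have [ab|ab] := eqVneq a b; have [bc|bc] := eqVneq b c.
- by subst b c; rewrite /=; nf F HL HLe HR HRe.
- have {}cb : (c < b)%N.
    by rewrite ltn_neqAle cb andbT; apply: contra bc => /eqP/val_inj ->.
  by subst b; nf F HL HLe HR HRe; ring.
- have {}ba : (b < a)%N.
    by rewrite ltn_neqAle ba andbT; apply: contra ab => /eqP/val_inj ->.
  by subst c; nf F HL HLe HR HRe; ring.
- have {}cb : (c < b)%N.
    by rewrite ltn_neqAle cb andbT; apply: contra bc => /eqP/val_inj ->.
  have {}ba : (b < a)%N.
    by rewrite ltn_neqAle ba andbT; apply: contra ab => /eqP/val_inj ->.
  have ca := ltn_trans cb ba.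
  by nf F HL HLe HR HRe; ring.
Qed.

End Rewriting.

(** * Coefficients of normal forms and their independence of the reduction order *)

Section NormalForm.

Variables (r : nat) (K : comNzRingType).
Local Notation C := ('I_r * 'I_r)%type.
Variable z : seq C.
Implicit Types (c d e f : C) (s t u v w : seq C).

(** The coefficient of [z] in the normal form of [w], always reducing the leftmost descent. Fuel
    [weight w] suffices, since each reduction lowers the weight and a word of weight 0 has no
    descent. *)
Fixpoint nf_coef_fuel (k : nat) w : K :=
  if k is k'.+1 then
    if descent_split w is Some (u, c, d, v)
    then expand (fun e f => nf_coef_fuel k' (u ++ [:: e, f & v])) c d
    else (w == z)%:R
  else (w == z)%:R.

Definition nf_coef w : K := nf_coef_fuel (weight w) w.

Lemma nf_coef_fuelE k w : (weight w <= k)%N -> nf_coef_fuel k w = nf_coef w.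
Proof.
suff S n w' : (weight w' <= n)%N -> nf_coef_fuel n.+1 w' = nf_coef_fuel n w'.
  rewrite /nf_coef => /subnK <-; elim: (_ - _)%N => // n IH.
  by rewrite -IH addSn S // leq_addl.
elim: n w' => [|n IH] w'; rewrite ?leqn0 => wn.
  rewrite /=; case: descent_split (descent_splitP w') => [[[[u c] d] v]|] //.
  move=> [E cd]; case/andP: (cd) => dc _.
  suff: (0 < weight w')%N by rewrite (eqP wn).
  rewrite E /weight !map_cat !inv_cat /= dc; lia.
rewrite -[LHS]/(if _ is Some _ then _ else _).
rewrite -[RHS]/(if _ is Some _ then _ else _).
case: descent_split (descent_splitP w') => [[[[u c] d] v]|] // [E cd].
apply: eq_expand => // e f lt; apply: IH.
by rewrite -ltnS; apply: leq_trans wn; rewrite E.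
Qed.

Lemma nf_coef_sorted w : sorted (@no_descent r) w -> nf_coef w = (w == z)%:R.
Proof.
rewrite /nf_coef => sw; case: (weight w) => //= n.
case: descent_split (descent_splitP w) => [[[[u c] d] v]|] // [E cd].
by rewrite E sorted_descent in sw.
Qed.

Lemma nf_coef_split w : if descent_split w is Some (u, c, d, v)
  then nf_coef w = expand (fun e f => nf_coef (u ++ [:: e, f & v])) c d
  else nf_coef w = (w == z)%:R.
Proof.
rewrite -(@nf_coef_fuelE (weight w).+1) //=.
case: descent_split (descent_splitP w) => [[[[u c] d] v]|] // [E cd].
apply: eq_expand => // e f lt; apply: nf_coef_fuelE.
by rewrite E ltnW.
Qed.

(** Each expansion is a signed sum whose shape ignores [F], so the two summations can be exchanged.
    This settles disjoint descents. *)
Lemma expand_comm c d c' d' (F : C -> C -> C -> C -> K) :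
  expand (fun e f => expand (F e f) c' d') c d =
  expand (fun e' f' => expand (fun e f => F e f e' f') c d) c' d'.
Proof. by rewrite /expand; case: eqP => _; case: eqP => _ //; ring. Qed.

(* Bergman's diamond lemma: two descents of a word are disjoint, overlapping or
   equal. *)
Lemma nf_coef_expand u c d v : descent c d ->
  nf_coef (u ++ [:: c, d & v]) =
  expand (fun e f => nf_coef (u ++ [:: e, f & v])) c d.
Proof.
have [n] := ubnP (weight (u ++ [:: c, d & v])).
elim: n u c d v => // n IH u c d v; rewrite ltnS => wn cd.
pose E u c d v := expand (fun e f => nf_coef (u ++ [:: e, f & v])) c d.
(* Any two descents of the word yield the same expansion; by symmetry the first one may be taken to
   start no later. *)
have join u1 c1 d1 v1 u2 c2 d2 v2 :
    u ++ [:: c, d & v] = u1 ++ [:: c1, d1 & v1] ->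
    u ++ [:: c, d & v] = u2 ++ [:: c2, d2 & v2] ->
    descent c1 d1 -> descent c2 d2 -> (size u1 <= size u2)%N ->
    E u1 c1 d1 v1 = E u2 c2 d2 v2.
  move=> E1 E2 cd1 cd2 le12.
  have E12 : u1 ++ [:: c1, d1 & v1] = u2 ++ [:: c2, d2 & v2] by rewrite -E1.
  have Eu2 : u2 = u1 ++ drop (size u1) u2.
    rewrite -{1}[u2](cat_take_drop (size u1)); congr cat.
    have := congr1 (take (size u1)) E12.
    by rewrite take_size_cat // takel_cat.
  move: E12 E2; rewrite Eu2 -!catA; move: (drop _ _) => s {Eu2 le12}.
  move/(congr1 (drop (size u1))); rewrite !drop_size_cat //.
  (* Here [s] separates the two starting positions: length 0 means equal descents, length 1 an
     overlap, and length at least 2 disjoint descents. *)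
  case: s => [|c3 [|d3 s]] /= [<-].
  - by move=> <- <- _; rewrite cats0.
  - move=> Ec Ev; subst c2 v1 => E2.
    transitivity (expand (fun e f => nf_coef (u1 ++ [:: c1, e, f & v2])) d1 d2);
      last by apply: eq_expand => // e f _; rewrite -catA.
    apply: (@expand_overlap _ _ (fun e f g => nf_coef (u1 ++ [:: e, f, g & v2])))
      => // e f g lt.
    have {}lt : (weight (u1 ++ [:: e, f, g & v2]) < n)%N.
      by apply: leq_trans (lt _ _) _; rewrite -E2.
    split=> de; first by rewrite IH.
    have := IH (u1 ++ [:: e]) f g v2; rewrite -catA => -> //.
    by apply: eq_expand => // e' f' _; rewrite -catA.
  - move=> Ec Ev; subst d3 v1 => E2.
    rewrite /E.
    transitivity (expand (fun e f => expand (fun e' f' =>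
      nf_coef (u1 ++ [:: e, f & s ++ [:: e', f' & v2]])) c2 d2) c1 d1).
      apply: eq_expand => // e f lt.
      have := IH (u1 ++ [:: e, f & s]) c2 d2 v2; rewrite -catA /= => -> //.
        by apply: eq_expand => // e' f' _; rewrite -catA.
      by apply: leq_trans (lt _ _) _; rewrite -E2.
    rewrite expand_comm; apply: eq_expand => // e f lt.
    have := lt (u1 ++ [:: c1, d1 & s]) v2; rewrite -!catA /= => lt'.
    rewrite -IH //; apply: leq_trans lt' _; by rewrite -ltnS -E2.
(* The given descent is compared with the one that the definition of [nf_coef] reduces. *)
have := nf_coef_split (u ++ [:: c, d & v]).
case: descent_split (descent_splitP (u ++ [:: c, d & v])) => [[[[u1 c1] d1] v1]|].
  move=> [E1 cd1] ->.
  by case/orP: (leq_total (size u1) (size u)) => le; [| symmetry]; apply: join.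
by rewrite sorted_descent.
Qed.

End NormalForm.

(** * Finite sums: linear extension, monomials, and ideals as spans *)

Section LinearExtension.

Variables (I : choiceType) (K : comNzRingType) (V : lmodType K) (h : I -> V).

Definition lin_ext (f : {malg K[I]}) : V := \sum_(k <- msupp f) f@_k *: h k.

Lemma lin_extEw (d : {fset I}) f : (msupp f `<=` d)%fset ->
  lin_ext f = \sum_(k <- d) f@_k *: h k.
Proof.
move=> fd; rewrite /lin_ext (big_fset_incl _ fd) //= => k _ /mcoeff_outdom ->.
by rewrite scale0r.
Qed.

Lemma lin_ext_is_linear : linear lin_ext.
Proof.
move=> a f g; pose d := (msupp f `|` msupp g `|` msupp (a *: f + g))%fset.
rewrite !(@lin_extEw d); first last.
- by rewrite /d fsubsetU ?fsubset_refl ?orbT.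
- by rewrite /d -fsetUA fsubsetUl.
- by rewrite /d fsubsetU // fsubsetUr.
rewrite scaler_sumr -big_split /=; apply: eq_bigr => k _.
by rewrite mcoeffD mcoeffZ scalerDl scalerA.
Qed.

HB.instance Definition _ :=
  GRing.isLinear.Build K {malg K[I]} V _ lin_ext lin_ext_is_linear.

Lemma lin_extU a k : lin_ext << a *g k >> = a *: h k.
Proof.
rewrite (@lin_extEw [fset k]%fset) ?msuppU_le // big_seq_fset1.
by rewrite mcoeffUU.
Qed.

Lemma malgUE a k : << a *g k >> = a *: << k >> :> {malg K[I]}.
Proof.
by apply/malgP => k'; rewrite mcoeffZ !mcoeffU mulrnAr mulr1.
Qed.

End LinearExtension.

(** Scalars are central because [K] is commutative, even though the monoid need not be. *)
Lemma malg_scalerAr (M : monomType) (K : comNzRingType) a (f g : {malg K[M]}) :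
  a *: (f * g) = f * (a *: g).
Proof.
apply/malgP => k; rewrite mcoeffZ mcoeffMl.
rewrite (@mcoeffMlw _ _ (msupp f) (msupp g)) ?msuppZ_le // mulr_sumr.
apply: eq_bigr => k1 _; rewrite mulr_sumr; apply: eq_bigr => k2 _.
by rewrite mcoeffZ mulrnAr mulrCA.
Qed.

Section Monomials.

Variables (r : nat) (K : comNzRingType).
Local Notation C := ('I_r * 'I_r)%type.
Local Notation finsum := {malg K[biword r]}.
Implicit Types (s t : seq C) (u v : biword r).

Definition monom s : finsum := << FMonom s >>.

Lemma monomM s t : monom s * monom t = monom (s ++ t).
Proof.
rewrite /monom malgM_def fgmulUU mulr1; congr (<< _ *g _ >>).
exact: fmmulE.
Qed.

Definition sandwich u v (f : finsum) : finsum := << u >> * f * << v >>.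

Lemma sandwich_is_linear u v : linear (sandwich u v).
Proof.
by move=> a f g; rewrite /sandwich mulrDr mulrDl -malg_scalerAr -scalerAl.
Qed.

HB.instance Definition _ u v :=
  GRing.isLinear.Build K finsum finsum _ (sandwich u v) (sandwich_is_linear u v).

Lemma sandwich_monom u v s : sandwich u v (monom s) = monom (u ++ s ++ v).
Proof.
by rewrite /sandwich -{1}(fmK u) -{1}(fmK v) -/(monom u) -/(monom v) !monomM catA.
Qed.

End Monomials.

Section Sandwich.

Variables (r : nat) (K : comNzRingType) (G : {malg K[biword r]} -> Prop).
Local Notation finsum := {malg K[biword r]}.

Lemma two_sided_idealZ a f : two_sided_ideal G f -> two_sided_ideal G (a *: f).
Proof.
move=> Gf; have -> : a *: f = (a *: 1) * f by rewrite -scalerAl mul1r.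
exact: two_sided_idealMl.
Qed.

Lemma two_sided_idealN f : two_sided_ideal G f -> two_sided_ideal G (- f).
Proof. by rewrite -scaleN1r; exact: two_sided_idealZ. Qed.

(** The ideal is the linear span of the products [u * g * v] with [u], [v] biwords and [g] a
    generator, so a linear property need only be checked on these. *)
Lemma two_sided_ideal_span (P : finsum -> Prop) :
    P 0 -> (forall f g, P f -> P g -> P (f + g)) ->
    (forall a f, P f -> P (a *: f)) ->
    (forall (u v : biword r) g, G g -> P (sandwich u v g)) ->
  forall f, two_sided_ideal G f -> P f.
Proof.
move=> P0 PD PZ PG f If.
(* With arbitrary outer factors the induction passes through multiplication on either side. *)
suff S f1 f2 : P (f1 * f * f2) by have := S 1 1; rewrite mul1r mulr1.
elim: If f1 f2 => [g Gg||f' g _ IHf _ IHg|f' g _ IHg|f' g _ IHf] f1 f2.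
- rewrite -mulrA {1}(monalgE f1) mulr_suml.
  apply: (big_ind P) => // u _; rewrite mulrA {1}(monalgE f2) mulr_sumr.
  apply: (big_ind P) => // v _.
  rewrite (malgUE _ u) (malgUE _ v) -malg_scalerAr -!scalerAl.
  exact/PZ/PZ/PG.
- by rewrite mulr0 mul0r.
- by rewrite mulrDr mulrDl; apply: PD.
- by rewrite mulrA.
- by rewrite -!mulrA mulrA.
Qed.

End Sandwich.

(** * Irreducible biwords span and are independent modulo the ideal, for finite sums *)

Section Relations.

Variables (r : nat) (K : comNzRingType).
Local Notation C := ('I_r * 'I_r)%type.
Local Notation finsum := {malg K[biword r]}.
Implicit Types (c d e : C) (s t : seq C) (u v w : biword r).

Lemma rel1P (g : finsum) : rel1 g <->
  exists c d, descent c d /\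
    g = monom K [:: c; d] - expand (fun e f => monom K [:: e; f]) c d.
Proof.
split=> [[x [y [a [b [yx ba ->]]]]]|[[x a] [[y b] [/andP[/= yx ba] ->]]]].
  exists (x, a), (y, b); split; first exact/andP.
  by rewrite /bracket /expand /monom /bi2 /=; case: eqP => [<-|_]; reflexivity.
exists x, y, a, b; split; [exact: yx | exact: ba |].
by rewrite /bracket /expand /monom /bi2 /=; case: eqP => [<-|_]; reflexivity.
Qed.

Lemma expand_linear (V W : lmodType K) (L : {linear V -> W}) (F : C -> C -> V)
    c d :
  L (expand F c d) = expand (fun e f => L (F e f)) c d.
Proof. by rewrite /expand; case: ifP => _ //; rewrite linearB linearD. Qed.

Lemma expand_scale (V : lmodType K) a (F : C -> C -> V) c d :
  a *: expand F c d = expand (fun e f => a *: F e f) c d.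
Proof. by rewrite /expand; case: ifP => _ //; rewrite scalerBr scalerDr. Qed.

Lemma sandwich_rel1 u v c d : descent c d ->
  sandwich u v (monom K [:: c; d] - expand (fun e f => monom K [:: e; f]) c d) =
  monom K (u ++ [:: c, d & v])
  - expand (fun e f => monom K (u ++ [:: e, f & v])) c d.
Proof.
move=> cd; rewrite linearB /= sandwich_monom (expand_linear (sandwich u v)).
congr (_ - _).
by apply: eq_expand => // e f _; exact: sandwich_monom.
Qed.

(** On a relation placed between two biwords the functional vanishes by [nf_coef_expand]. *)
Lemma nf_coef_ideal z (f : finsum) : two_sided_ideal (@rel1 r K) f ->
  lin_ext (fun w => nf_coef K z w : K^o) f = 0.
Proof.
pose L : {linear finsum -> K^o} := lin_ext (fun w => nf_coef K z w : K^o).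
have LE s : L (monom K s) = nf_coef K z s.
  by rewrite /L /= /monom lin_extU scale1r.
move: f; apply: (two_sided_ideal_span (P := fun f => L f = 0)).
- exact: linear0.
- by move=> f g Lf Lg; rewrite linearD Lf Lg addr0.
- by move=> a f Lf; rewrite linearZ Lf; exact: mulr0.
move=> u v _ /rel1P[c [d [cd ->]]].
rewrite sandwich_rel1 // linearB (expand_linear L) LE nf_coef_expand //.
apply/eqP; rewrite subr_eq0; apply/eqP.
by apply: eq_expand => // e f _; rewrite LE.
Qed.

Definition irr_supported (f : finsum) : Prop :=
  forall w, f@_w != 0 -> irreducible w.

(** On irreducible words [nf_coef] is the Kronecker delta at [z], so the functional that kills the
    ideal reads off the coefficient of [f] at [z]. *)
Lemma irr_supported_ideal f :
  irr_supported f -> two_sided_ideal (@rel1 r K) f -> f = 0.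
Proof.
move=> f_irr If; apply/malgP => z; rewrite mcoeff0.
have [->//|/f_irr z_irr] := eqVneq f@_z 0.
rewrite -[RHS](nf_coef_ideal z If) /lin_ext.
have -> : \sum_(k <- msupp f) f@_k *: (nf_coef K z k : K^o) =
    \sum_(k <- msupp f) f@_k *+ (k == z).
  rewrite !big_seq; apply: eq_bigr => k kf.
  rewrite nf_coef_sorted; last by apply: f_irr; rewrite mcoeff_neq0.
  by rewrite fmP; exact: mulr_natr.
rewrite {1}(monalgE f) raddf_sum /=.
by apply: eq_bigr => k _; rewrite mcoeffU.
Qed.

(** Fixing the length of the words of [g] lets the normal forms of all degrees be assembled into one
    formal sum. *)
Definition congruent n (f : finsum) : Prop := exists g : finsum,
  [/\ irr_supported g, forall w, g@_w != 0 -> size w = n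
    & two_sided_ideal (@rel1 r K) (f - g)].

Lemma congruentD n f g : congruent n f -> congruent n g -> congruent n (f + g).
Proof.
move=> [f' [irrf szf If]] [g' [irrg szg Ig]]; exists (f' + g'); split.
- move=> w; rewrite mcoeffD.
  by have [->|/irrf //] := eqVneq f'@_w 0; rewrite add0r; exact: irrg.
- move=> w; rewrite mcoeffD.
  by have [->|/szf //] := eqVneq f'@_w 0; rewrite add0r; exact: szg.
- by rewrite opprD addrACA; exact: two_sided_idealD.
Qed.

Lemma congruentZ n a f : congruent n f -> congruent n (a *: f).
Proof.
move=> [g [irrg szg Ig]]; exists (a *: g); split.
- move=> w; rewrite mcoeffZ => agw; apply: irrg.
  by apply: contraNneq agw => ->; rewrite mulr0.
- move=> w; rewrite mcoeffZ => agw; apply: szg.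
  by apply: contraNneq agw => ->; rewrite mulr0.
- by rewrite -scalerBr; exact: two_sided_idealZ.
Qed.

Lemma congruent0 n : congruent n 0.
Proof.
exists 0; split; try by move=> w; rewrite mcoeff0 eqxx.
by rewrite subr0; exact: two_sided_ideal0.
Qed.

Lemma congruent_monom s : congruent (size s) (monom K s).
Proof.
have [n] := ubnP (weight s); elim: n s => // n IH s; rewrite ltnS => sn.
have := descent_splitP s; case: descent_split => [[[[u c] d] v]|] => [[E cd]|irr].
  have szE e f : size s = size (u ++ [:: e, f & v]) by rewrite E !size_cat.
  have : congruent (size s) (expand (fun e f => monom K (u ++ [:: e, f & v])) c d).
    (* The guard, true for every pair that occurs, makes the induction hypothesis available
       uniformly in [e] and [f]; the value 0 is a dummy. *)
    rewrite (@eq_expand _ _ _ (fun e f =>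
        if (weight (u ++ [:: e, f & v]) < weight s)%N
        then monom K (u ++ [:: e, f & v]) else 0)) //; last first.
      by move=> e f lt; rewrite {1}E lt.
    have G e f : congruent (size s) (if (weight (u ++ [:: e, f & v]) < weight s)%N
        then monom K (u ++ [:: e, f & v]) else 0).
      case: ifP => [lt|_]; last exact: congruent0.
      by rewrite (szE e f); apply: IH; exact: leq_trans lt sn.
    rewrite /expand; case: ifP => _ //.
    by rewrite -scaleN1r; do !apply: congruentD => //; apply: congruentZ.
  case=> g [irrg szg Ig]; exists g; split=> //.
  (* The difference splits at the expansion: the first part is a relation in context, the second is
     [Ig]. *)
  rewrite -(subrKA (expand (fun e f => monom K (u ++ [:: e, f & v])) c d)).
  apply: two_sided_idealD Ig.
  rewrite {1}E -(@sandwich_rel1 (FMonom u) (FMonom v)) //.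
  apply: two_sided_idealMr; apply: two_sided_idealMl.
  by apply: two_sided_ideal_gen; apply/rel1P; exists c, d.
exists (monom K s); split; last by rewrite subrr; exact: two_sided_ideal0.
- move=> w; rewrite mcoeffU; have [<- //|_] := eqVneq (FMonom s) w.
  by rewrite eqxx.
- move=> w; rewrite mcoeffU; have [<- //|_] := eqVneq (FMonom s) w.
  by rewrite eqxx.
Qed.

End Relations.

(** * From finite sums to formal sums, degree by degree *)

Section FormalSums.

Variables (r : nat) (K : comNzRingType).
Implicit Types (n : nat) (w : biword r).

Local Notation finsum := {malg K[biword r]}.

Lemma homogE n (E : series r K) :
  homog n E = \sum_(t : n.-tuple ('I_r * 'I_r)%type) E (FMonom t) *: monom K t.
Proof. by apply: eq_bigr => t _; rewrite malgUE. Qed.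

Lemma mcoeff_homog n (E : series r K) w :
  (homog n E)@_w = if size w == n then E w else 0.
Proof.
rewrite /homog raddf_sum /=; case: eqP => [<-|szw].
  rewrite (bigD1 (in_tuple w)) //= big1 => [|t tw].
    by rewrite mcoeffU fmP eqxx fmK addr0.
  by rewrite mcoeffU fmP; case: eqP => // tE; case/eqP: tw; exact: val_inj.
rewrite big1 // => t _; rewrite mcoeffU fmP; case: eqP => // tE; case: szw.
by rewrite -tE /= size_tuple.
Qed.

Lemma in_ideal1E (E : series r K) : (E \in ideal1 r K) <->
  forall n, two_sided_ideal (@rel1 r K) (homog n E).
Proof. by split=> [/asboolP|?]; last exact/asboolP. Qed.

(** Existence: normalise every homogeneous component. Uniqueness: each component of a difference is
    irreducibly supported and in the ideal, hence zero. *)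
Lemma formal_basis_irr : formal_basis (ideal1 r K) (@irreducible r).
Proof.
move=> x; pose E0 := cls_repr x.
have cong n : congruent n (homog n E0).
  rewrite homogE; apply: (big_ind (congruent n)) => [|f g|t _].
  - exact: congruent0.
  - exact: congruentD.
  - by apply: congruentZ; rewrite -{1}(size_tuple t); exact: congruent_monom.
have [g gP] := choice cong.
(* The coefficient at [w] is taken from the normal form in the degree of [w]. *)
pose E : series r K := fun w => (g (size w))@_w.
have gE n : homog n E = g n.
  apply/malgP => w; rewrite mcoeff_homog; case: eqP => [<-//|szw].
  have [_ szg _] := gP n; apply/esym/eqP; apply: contraPT isT => /szg wn.
  by case: szw.
have clsE : cls (ideal1 r K) E = x.
  rewrite -(cls_reprK x); apply/cls_eq/in_ideal1E => n; rewrite linearB /= gE.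
  by have [_ _ /two_sided_idealN] := gP n; rewrite opprB.
have irrE w : ~~ irreducible w -> E w = 0.
  have [irrg _ _] := gP (size w).
  by move=> /negP irrw; apply/eqP; apply: contra_notT irrw => /irrg.
exists E; split=> [//|E' [irrE' clsE']]; apply/funext => w.
apply/eqP; rewrite -subr_eq0; apply/eqP.
have /in_ideal1E/(_ (size w)) I : E - E' \in ideal1 r K.
  by apply/cls_eq; rewrite clsE'.
have /irr_supported_ideal : irr_supported (homog (size w) (E - E')).
  move=> w'; rewrite mcoeff_homog; case: ifP => _; last by rewrite eqxx.
  apply: contraNT => irrw'.
  apply/eqP; rewrite [LHS]/(E w' - E' w') (irrE _ irrw') (irrE' _ irrw').
  exact: subrr.
by move=> /(_ I)/malgP/(_ w); rewrite mcoeff_homog eqxx mcoeff0.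
Qed.

Definition twist (h : biword r -> K) (f : finsum) : finsum :=
  lin_ext (fun w => << h w *g w >> : finsum) f.

Lemma twist_is_linear h : linear (twist h).
Proof. exact: linearP. Qed.

HB.instance Definition _ h :=
  GRing.isLinear.Build K finsum finsum _ (twist h) (twist_is_linear h).

Lemma mcoeff_twist h f w : (twist h f)@_w = h w * f@_w.
Proof.
rewrite /twist /lin_ext raddf_sum [in RHS](monalgE f) raddf_sum mulr_sumr.
apply: eq_bigr => k _ /=; rewrite mcoeffZ !mcoeffU.
by case: eqP => [->|_]; rewrite ?mulr0n ?mulr0 // mulrC.
Qed.

Lemma homog_twist n h (E : series r K) :
  homog n (fun w => E w * h w) = twist h (homog n E).
Proof.
apply/malgP => w; rewrite mcoeff_twist !mcoeff_homog.
by case: ifP => _; [exact: mulrC | rewrite mulr0].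
Qed.

End FormalSums.

(** * The diagonal twist exchanges the two ideals of finite sums *)

Section Deformation.

(* [h k] plays the role of [q ^ k]. *)
Variables (r : nat) (K : comNzRingType) (h : int -> K).
Hypotheses (h0 : h 0 = 1) (hD : forall k l, h (k + l) = h k * h l).
Local Notation C := ('I_r * 'I_r)%type.
Local Notation finsum := {malg K[biword r]}.
Implicit Types (c d e : C) (s t : seq C) (u v w : biword r) (k : int).

Local Notation phi_fin := (twist (fun w : biword r => h (inv_minus w))).
Local Notation phi_fin_inv := (twist (fun w : biword r => h (- inv_minus w))).

Lemma phi_finK : cancel phi_fin phi_fin_inv.
Proof.
move=> f; apply/malgP => w; rewrite !mcoeff_twist mulrA -hD.
by rewrite addNr h0 mul1r.
Qed.

Lemma phi_fin_monom s :
  phi_fin (monom K s) = h (inv_minus (FMonom s)) *: monom K s.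
Proof. by rewrite /twist /monom lin_extU scale1r malgUE. Qed.

Lemma inv_minus_pair c d :
  inv_minus (FMonom [:: c; d] : biword r) =
  (d.2 < c.2)%N%:Z - (d.1 < c.1)%N%:Z.
Proof. by rewrite /inv_minus /top_row /bottom_row /= !inversionsE /= !addn0. Qed.

Lemma inv_minus_factor u v s t :
    perm_eq (map fst s) (map fst t) -> perm_eq (map snd s) (map snd t) ->
  inv_minus (FMonom (u ++ s ++ v)) =
  inv_minus (FMonom (u ++ t ++ v))
  + (inv_minus (FMonom s : biword r) - inv_minus (FMonom t : biword r)).
Proof.
rewrite /inv_minus /top_row /bottom_row /= !map_cat !inversionsE.
have aux (a1 a2 b1 b2 c1 c2 d1 d2 : nat) :
    (a1 + b1 = c1 + d1)%N -> (a2 + b2 = c2 + d2)%N ->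
  a2%:Z - a1%:Z = c2%:Z - c1%:Z + (d2%:Z - d1%:Z - (b2%:Z - b1%:Z)) by lia.
by move=> p1 p2; apply: aux; exact: inv_factor.
Qed.

Definition inv_shift c d e f : int :=
  inv_minus (FMonom [:: e; f] : biword r)
  - inv_minus (FMonom [:: c; d] : biword r).

(** A uniform shape for the q-relations: the exponent of each term is its change of [inv_minus], so
    no explicit powers enter the argument. *)
Definition q_rel (g : finsum) : Prop := exists c d, descent c d /\
  g = monom K [:: c; d]
      - expand (fun e f => h (inv_shift c d e f) *: monom K [:: e; f]) c d.

Lemma sandwich_q_rel u v c d : descent c d ->
  sandwich u v (monom K [:: c; d]
      - expand (fun e f => h (inv_shift c d e f) *: monom K [:: e; f]) c d) =
  monom K (u ++ [:: c, d & v])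
  - expand (fun e f => h (inv_shift c d e f) *: monom K (u ++ [:: e, f & v])) c d.
Proof.
move=> cd; rewrite linearB /= sandwich_monom (expand_linear (sandwich u v)).
congr (_ - _); apply: eq_expand => // e f _.
rewrite linearZ; congr (_ *: _); exact: sandwich_monom.
Qed.

(** By [inv_minus_factor] the exponents of the terms differ from that of the leading word by
    [inv_shift], whatever the context, so the power for the leading word factors out. *)
Lemma phi_fin_rel u v c d : descent c d ->
  phi_fin (sandwich u v
    (monom K [:: c; d] - expand (fun e f => monom K [:: e; f]) c d)) =
  h (inv_minus (FMonom (u ++ [:: c, d & v]))) *: sandwich u v
    (monom K [:: c; d]
     - expand (fun e f => h (inv_shift c d e f) *: monom K [:: e; f]) c d).
Proof.
move=> cd; rewrite sandwich_rel1 // sandwich_q_rel // linearB.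
rewrite (expand_linear phi_fin) scalerBr expand_scale /= phi_fin_monom.
congr (_ - _); apply: eq_expand_perm => // e f p1 p2 _.
rewrite /= phi_fin_monom scalerA -hD; congr (h _ *: _).
exact: (inv_minus_factor u v p1 p2).
Qed.

Lemma phi_fin_ideal f :
  two_sided_ideal (@rel1 r K) f -> two_sided_ideal q_rel (phi_fin f).
Proof.
move: f; apply: (two_sided_ideal_span
  (P := fun f => two_sided_ideal q_rel (phi_fin f))).
- by rewrite linear0; exact: two_sided_ideal0.
- by move=> f g If Ig; rewrite linearD /=; apply: two_sided_idealD.
- by move=> a f If; rewrite linearZ; exact: two_sided_idealZ.
move=> u v _ /rel1P[c [d [cd ->]]]; rewrite phi_fin_rel //.
apply: two_sided_idealZ; apply: two_sided_idealMr; apply: two_sided_idealMl.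
by apply: two_sided_ideal_gen; exists c, d.
Qed.

Lemma phi_fin_inv_ideal f :
  two_sided_ideal q_rel f -> two_sided_ideal (@rel1 r K) (phi_fin_inv f).
Proof.
move: f; apply: (two_sided_ideal_span
  (P := fun f => two_sided_ideal (@rel1 r K) (phi_fin_inv f))).
- by rewrite linear0; exact: two_sided_ideal0.
- by move=> f g If Ig; rewrite linearD /=; apply: two_sided_idealD.
- by move=> a f If; rewrite linearZ; exact: two_sided_idealZ.
move=> u v _ [c [d [cd ->]]].
set k := inv_minus (FMonom (u ++ [:: c, d & v])).
(* Writing 1 as [h (- k) * h k] exhibits the q-relation in context as a multiple of a twisted
   relation. *)
rewrite -[X in phi_fin_inv X]scale1r -h0 -(addNr k) hD -scalerA.
rewrite -phi_fin_rel // linearZ; apply: two_sided_idealZ; rewrite /= phi_finK.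
apply: two_sided_idealMr; apply: two_sided_idealMl.
by apply: two_sided_ideal_gen; apply/rel1P; exists c, d.
Qed.

End Deformation.

(** * The induced isomorphism and the transported basis *)

Section PhiIso.

Variable r : nat.
Local Notation K := laurent.

Lemma lqD k l : lq ^ (k + l) = lq ^ k * lq ^ l.
Proof. exact/exprzDr/lq_unit. Qed.

(** The leading pair has [inv_minus] equal to -1 when [a = b] and to 0 otherwise; comparing with the
    other pairs gives the exponents 1, 0 and -1 of the brackets. *)
Lemma bracketqE (x y a b : 'I_r) : (y < x)%N -> (b <= a)%N ->
  bracketq x y a b = expand (fun e f =>
    lq ^ inv_shift (x, a) (y, b) e f *: monom K [:: e; f]) (x, a) (y, b).
Proof.
move=> yx ba; rewrite /bracketq /expand /=.
have [ab|ab] := eqVneq a b.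
  subst b.
  have -> : inv_shift (x, a) (y, a) (y, a) (x, a) = 1.
    by rewrite /inv_shift !inv_minus_pair /= ltnn yx (ltn_asymF yx).
  by rewrite expr1z; reflexivity.
have {}ba : (b < a)%N.
  by rewrite ltn_neqAle ba andbT; apply: contra ab => /eqP/val_inj ->.
have -> : inv_shift (x, a) (y, b) (y, b) (x, a) = 0.
  by rewrite /inv_shift !inv_minus_pair /= yx ba (ltn_asymF yx) (ltn_asymF ba).
have -> : inv_shift (x, a) (y, b) (y, a) (x, b) = 1.
  by rewrite /inv_shift !inv_minus_pair /= yx ba (ltn_asymF yx).
have -> : inv_shift (x, a) (y, b) (x, b) (y, a) = -1.
  by rewrite /inv_shift !inv_minus_pair /= yx ba (ltn_asymF ba).
rewrite expr0z scale1r expr1z exprN1; reflexivity.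
Qed.

Lemma relqE : @relq r = q_rel (exprz lq).
Proof.
apply/funext => g; apply/propext.
split=> [[x [y [a [b [yx ba ->]]]]]|[[x a] [[y b] [/andP[/= yx ba] ->]]]].
  exists (x, a), (y, b); split; first exact/andP.
  by rewrite bracketqE //; reflexivity.
exists x, y, a, b; split; [exact: yx | exact: ba |].
by rewrite bracketqE //; reflexivity.
Qed.

(** One direction makes [phibar] well defined, the other makes it injective. *)
Lemma phi_ideal (E : series r K) : (phi E \in idealq r) = (E \in ideal1 r K).
Proof.
apply/asboolP/asboolP; rewrite relqE => IE n.
  rewrite -(phi_finK (expr0z lq) lqD (homog n E)) -homog_twist.
  exact: (phi_fin_inv_ideal (expr0z lq) lqD).
by rewrite homog_twist; exact: (phi_fin_ideal lqD).
Qed.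

Definition phibar (x : lmod_quot (ideal1 r K)) : lmod_quot (idealq r) :=
  cls (idealq r) (phi (cls_repr x)).

Lemma phibar_cls E : phibar (cls (ideal1 r K) E) = cls (idealq r) (phi E).
Proof.
apply/cls_eq; rewrite -linearB phi_ideal; apply/cls_eq; exact: cls_reprK.
Qed.

Lemma phibar_is_linear : linear phibar.
Proof.
move=> a x y; rewrite -(cls_reprK x) -(cls_reprK y) -linearP !phibar_cls.
by rewrite linearP linearP.
Qed.

HB.instance Definition _ := GRing.isLinear.Build K
  (lmod_quot (ideal1 r K)) (lmod_quot (idealq r)) _ phibar phibar_is_linear.

Lemma phibar_bij : bijective phibar.
Proof.
have [psi phiK psiK] := @phi_bij r.
exists (fun y => cls (ideal1 r K) (psi (cls_repr y))) => [x|y].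
  rewrite -[RHS]cls_reprK; apply/cls_eq; rewrite -phi_ideal linearB /= psiK.
  by apply/cls_eq; exact: cls_reprK.
by rewrite phibar_cls psiK cls_reprK.
Qed.

(** Powers of q are units, so [phi] preserves supports, and expansions in irreducible biwords are
    carried along [phibar]. *)
Lemma formal_basisq_irr : formal_basis (idealq r) (@irreducible r).
Proof.
have [psi phiK psiK] := @phi_bij r.
have phi0 (E : series r K) w : phi E w = 0 <-> E w = 0.
  rewrite /phi; split=> [|->]; last by rewrite mul0r.
  move=> Ew; rewrite -[E w](mulrK (unitrXz (inv_minus w) lq_unit)) Ew.
  by rewrite mul0r.
move=> x; have [phibar_inv phibarK phibar_invK] := phibar_bij.
have [E [[irrE clsE] uniqE]] := formal_basis_irr (phibar_inv x).
exists (phi E); split=> [|E' [irrE' clsE']].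
  split=> [w irrw|]; first by apply/phi0/irrE.
  by rewrite -phibar_cls clsE.
rewrite -(psiK E'); congr phi; apply: uniqE; split=> [w irrw|].
  by apply/phi0; rewrite psiK; exact: irrE'.
by apply: (can_inj phibarK); rewrite phibar_cls psiK clsE'.
Qed.

End PhiIso.

Theorem theorem2 (r : nat) (hr : (2 <= r)%N) :
  (exists phibar :
     {linear lmod_quot (ideal1 r laurent) -> lmod_quot (idealq r)},
     (forall E : series r laurent,
        phibar (cls (ideal1 r laurent) E) = cls (idealq r) (phi E)) /\
     bijective phibar) /\
  formal_basis (idealq r) (@irreducible r) /\
  formal_basis (ideal1 r int) (@irreducible r).
Proof.
split; last by split; [exact: formal_basisq_irr | exact: formal_basis_irr].
by exists (@phibar r); split; [exact: phibar_cls | exact: phibar_bij].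
Qed.
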